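(* Let $p:V(\mathcal{D})\to\mathbb{C}$ be a parallelogram realization of a bipartite quad-graph $\mathcal{D}$. Suppose that the trivial solution $z_0=p$ of the corresponding cross-ratio system belongs to a differentiable one-parameter family of solutions $z_\epsilon:V(\mathcal{D})\to\mathbb{C}$, $\epsilon\in(-\epsilon_0,\epsilon_0)$, of the same cross-ratio system, and let $w_\epsilon:V(\mathcal{D})\to\mathbb{C}$ be the corresponding solutions of the Hirota system (forming a differentiable family with $w_0\equiv1$). Then both functions $f,g:V(\mathcal{D})\to\mathbb{C}$ defined by $$g=\frac{dz_\epsilon}{d\epsilon}\bigg|_{\epsilon=0},\qquad f=\bigg(w_\epsilon^{-1}\frac{dw_\epsilon}{d\epsilon}\bigg)_{\epsilon=0}$$ solve the discrete Cauchy-Riemann equations: for every face $(x_0,y_0,x_1,y_1)$ of $\mathcal{D}$, $$\frac{f(y_1)-f(y_0)}{f(x_1)-f(x_0)}=\frac{\theta_1-\theta_0}{\theta_1+\theta_0}=\frac{p(y_1)-p(y_0)}{p(x_1)-p(x_0)},$$ and likewise for $g$ (the equations being understood as linear relations after clearing the denominator on the left).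
   Context: $\mathcal{D}$ is a bipartite quad-graph (cell decomposition of a surface with all quadrilateral faces); faces are written $(x_0,y_0,x_1,y_1)$ with $x$'s black and $y$'s white. A parallelogram realization is a map $p:V(\mathcal{D})\to\mathbb{C}$ with $p(y)-p(x)=\theta(x,y)$, where $\theta$ is a labelling of directed edges: on each face $\theta_0=p(y_0)-p(x_0)=p(x_1)-p(y_1)$, $\theta_1=p(y_1)-p(x_0)=p(x_1)-p(y_0)$, with $\theta_0,\theta_1\ne0$, $\theta_0\neq\pm\theta_1$. Cross-ratio system: on each face, $q(z(x_0),z(y_0),z(x_1),z(y_1))=\theta_0^2/\theta_1^2$, with $q(a,b,c,d)=\frac{(a-b)(c-d)}{(b-c)(d-a)}$; $z=p$ is a solution. Hirota system: on each face, $\theta_0w(x_0)w(y_0)+\theta_1w(y_0)w(x_1)-\theta_0w(x_1)w(y_1)-\theta_1w(y_1)w(x_0)=0$; $w\equiv1$ is a solution. Solutions are related by $z(y)-z(x)=w(x)w(y)\big(p(y)-p(x)\big)$ for all edges $(x,y)$ of $\mathcal{D}$; this determines $w$ from $z$ up to a black-white scaling ($w\to cw$ on black, $w\to c^{-1}w$ on white vertices), and $z$ from $w$ up to an additive constant. *)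

(* Defs.v *)
From Stdlib Require Import Reals List Relations.
From Coquelicot Require Import Coquelicot.

Open Scope R_scope.
Open Scope C_scope.

Inductive cyc4 : Set := q0 | q1 | q2 | q3.

Definition next (i : cyc4) : cyc4 :=
  match i with q0 => q1 | q1 => q2 | q2 => q3 | q3 => q0 end.

(* A cell decomposition of a surface into quadrilaterals whose 1-skeleton has
   a black/white vertex colouring, encoded by its incidences.  The cells may
   be infinite in number, parallel edges are allowed, and the surface may be
   non-orientable, have a boundary or be disconnected.  The corners of a face
   are listed in cyclic order starting at a black one, and [side f i] runs
   from [corner f i] to [corner f (next i)]. *)
Record bipartite_quad_graph : Type := {
  vertex : Type;
  edge : Type;
  face : Type;
  black : vertex -> bool;
  black_end : edge -> vertex;
  white_end : edge -> vertex;
  corner : face -> cyc4 -> vertex;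
  side : face -> cyc4 -> edge;
  black_end_black : forall e, black (black_end e) = true;
  white_end_white : forall e, black (white_end e) = false;
  side_q0 : forall f, black_end (side f q0) = corner f q0 /\
                      white_end (side f q0) = corner f q1;
  side_q1 : forall f, white_end (side f q1) = corner f q1 /\
                      black_end (side f q1) = corner f q2;
  side_q2 : forall f, black_end (side f q2) = corner f q2 /\
                      white_end (side f q2) = corner f q3;
  side_q3 : forall f, white_end (side f q3) = corner f q3 /\
                      black_end (side f q3) = corner f q0;
  (* An edge carries two face sides, or only one ([s1 = s2]) when it lies on
     the boundary of the surface. *)
  edge_sides : forall e, exists s1 s2 : face * cyc4,
    forall s, side (fst s) (snd s) = e <-> s = s1 \/ s = s2;
  (* The link of [v], with a node for each edge at [v] and an arc for each
     face corner at [v], is a non-empty finite connected graph; as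
     [edge_sides] bounds its degrees by 2, it is a cycle or a path, so [v] is
     an interior or a boundary point of the surface. *)
  link_nonempty : forall v, exists e, black_end e = v \/ white_end e = v;
  link_finite : forall v, exists l : list edge,
    forall e, black_end e = v \/ white_end e = v -> In e l;
  link_connected : forall v e e',
    black_end e = v \/ white_end e = v ->
    black_end e' = v \/ white_end e' = v ->
    clos_refl_sym_trans edge
      (fun a b => exists f i, corner f (next i) = v /\
                              a = side f i /\ b = side f (next i)) e e'
}.

(* [(x, y)] is a directed edge, of either orientation. *)
Definition adjacent (D : bipartite_quad_graph) (x y : vertex D) : Prop :=
  exists e : edge D, (black_end D e = x /\ white_end D e = y) \/
                     (white_end D e = x /\ black_end D e = y).

(* All four ways of listing the corners of a face in cyclic order, in either
   sense of rotation, starting at a black one. *)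
Definition is_face (D : bipartite_quad_graph) (x0 y0 x1 y1 : vertex D) : Prop :=
  exists f : face D,
    let c := corner D f in
    (x0, y0, x1, y1) = (c q0, c q1, c q2, c q3) \/
    (x0, y0, x1, y1) = (c q2, c q3, c q0, c q1) \/
    (x0, y0, x1, y1) = (c q0, c q3, c q2, c q1) \/
    (x0, y0, x1, y1) = (c q2, c q1, c q0, c q3).

(* The labelling [theta] is meaningful on directed edges only. *)
Definition parallelogram_realization (D : bipartite_quad_graph)
    (theta : vertex D -> vertex D -> C) (p : vertex D -> C) : Prop :=
  (forall x y, adjacent D x y -> p y - p x = theta x y) /\
  (forall x0 y0 x1 y1, is_face D x0 y0 x1 y1 ->
     theta x0 y0 = theta y1 x1 /\ theta x0 y1 = theta y0 x1 /\
     theta x0 y0 <> 0 /\ theta x0 y1 <> 0 /\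
     theta x0 y0 <> theta x0 y1 /\ theta x0 y0 <> - theta x0 y1).

Definition cross_ratio (a b c d : C) : C :=
  ((a - b) * (c - d)) / ((b - c) * (d - a)).

(* Since [/ 0 = 0] in [C] and the right-hand side is non-zero on a
   parallelogram realization, a solution has all four differences along the
   sides of a face non-zero. *)
Definition cross_ratio_solution (D : bipartite_quad_graph)
    (theta : vertex D -> vertex D -> C) (z : vertex D -> C) : Prop :=
  forall x0 y0 x1 y1, is_face D x0 y0 x1 y1 ->
    cross_ratio (z x0) (z y0) (z x1) (z y1) =
      (theta x0 y0 * theta x0 y0) / (theta x0 y1 * theta x0 y1).

Definition hirota_solution (D : bipartite_quad_graph)
    (theta : vertex D -> vertex D -> C) (w : vertex D -> C) : Prop :=
  forall x0 y0 x1 y1, is_face D x0 y0 x1 y1 ->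
    theta x0 y0 * w x0 * w y0 + theta x0 y1 * w y0 * w x1
      - theta x0 y0 * w x1 * w y1 - theta x0 y1 * w y1 * w x0 = 0.

Definition corresponding (D : bipartite_quad_graph)
    (p z w : vertex D -> C) : Prop :=
  forall x y, adjacent D x y -> z y - z x = w x * w y * (p y - p x).

(* Derivative of a complex-valued function of a real variable. *)
Definition is_derive_RC (h : R -> C) (t : R) (l : C) : Prop :=
  @is_derive R_AbsRing C_R_NormedModule h t l.

Definition differentiable_family (T : Type) (eps0 : R) (u : R -> T -> C) : Prop :=
  forall eps : R, (- eps0 < eps < eps0)%R ->
  forall v : T, exists l : C, is_derive_RC (fun t => u t v) eps l.

Definition discrete_cauchy_riemann (D : bipartite_quad_graph)
    (theta : vertex D -> vertex D -> C) (p f : vertex D -> C) : Prop :=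
  forall x0 y0 x1 y1, is_face D x0 y0 x1 y1 ->
    let theta0 := theta x0 y0 in
    let theta1 := theta x0 y1 in
    f y1 - f y0 = (theta1 - theta0) / (theta1 + theta0) * (f x1 - f x0) /\
    (theta1 - theta0) / (theta1 + theta0) = (p y1 - p y0) / (p x1 - p x0).

(* Main.v *)
(* Differentiating the Hirota equations at w = 1 gives exactly the discrete
   Cauchy-Riemann equations for f.  Differentiating the correspondence
   z(y) - z(x) = w(x) w(y) (p(y) - p(x)) at w = 1 gives
   g(y) - g(x) = (f(x) + f(y)) (p(y) - p(x)) on every edge, and the
   Cauchy-Riemann equations for g on a face follow algebraically from these
   edge relations and the equation for f. *)

Require Import Defs.
From Stdlib Require Import Reals.
From Coquelicot Require Import Coquelicot.

Open Scope R_scope.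
Open Scope C_scope.

(** [Re] and [Im] are real-linear maps, so they commute with differentiation; conversely, [h] is
    recombined as [Re h] times [(1, 0)] plus [Im h] times [(0, 1)]. *)
Lemma is_derive_RC_iff (h : R -> C) (t : R) (l : C) :
  is_derive_RC h t l <->
  is_derive (fun s => Re (h s)) t (Re l) /\ is_derive (fun s => Im (h s)) t (Im l).
Proof.
split.
- intros H; split.
  + exact (filterdiff_comp' h fst t _ _ H (filterdiff_linear fst is_linear_fst)).
  + exact (filterdiff_comp' h snd t _ _ H (filterdiff_linear snd is_linear_snd)).
- intros [Hr Hi]; unfold is_derive_RC.
  pose proof (@is_derive_plus R_AbsRing C_R_NormedModule _ _ t _ _
    (@is_derive_scal_l R_AbsRing C_R_NormedModule _ t _ ((1, 0)%R : C) Hr)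
    (@is_derive_scal_l R_AbsRing C_R_NormedModule _ t _ ((0, 1)%R : C) Hi)) as H.
  match type of H with @is_derive _ _ _ _ ?l' => replace l with l' end.
  + eapply is_derive_ext; [|exact H].
    intros s; apply injective_projections; cbn; unfold Re, Im; ring.
  + apply injective_projections; cbn; unfold Re, Im; ring.
Qed.

Lemma is_derive_RC_unique (h : R -> C) (t : R) (l l' : C) :
  is_derive_RC h t l -> is_derive_RC h t l' -> l = l'.
Proof.
intros [Hr Hi]%is_derive_RC_iff [Hr' Hi']%is_derive_RC_iff.
apply injective_projections.
- transitivity (Derive (fun s => Re (h s)) t);
    [symmetry|]; apply is_derive_unique; assumption.
- transitivity (Derive (fun s => Im (h s)) t);
    [symmetry|]; apply is_derive_unique; assumption.
Qed.

Lemma is_derive_RC_const (c : C) (t : R) : is_derive_RC (fun _ => c) t 0.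
Proof. exact (@is_derive_const R_AbsRing C_R_NormedModule c t). Qed.

Lemma is_derive_RC_plus (h k : R -> C) (t : R) (l m : C) :
  is_derive_RC h t l -> is_derive_RC k t m ->
  is_derive_RC (fun s => h s + k s) t (l + m).
Proof. exact (@is_derive_plus R_AbsRing C_R_NormedModule h k t l m). Qed.

Lemma is_derive_RC_minus (h k : R -> C) (t : R) (l m : C) :
  is_derive_RC h t l -> is_derive_RC k t m ->
  is_derive_RC (fun s => h s - k s) t (l - m).
Proof. exact (@is_derive_minus R_AbsRing C_R_NormedModule h k t l m). Qed.

(** Follows from the real product rule [M] applied to the four products of components in
    $\mathrm{Re}(hk)$ and $\mathrm{Im}(hk)$. *)
Lemma is_derive_RC_mult (h k : R -> C) (t : R) (l m : C) :
  is_derive_RC h t l -> is_derive_RC k t m ->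
  is_derive_RC (fun s => h s * k s) t (l * k t + h t * m).
Proof.
intros [Hr Hi]%is_derive_RC_iff [Kr Ki]%is_derive_RC_iff.
pose proof (fun a b c d H1 H2 =>
  @is_derive_mult R_AbsRing a b t c d H1 H2 Rmult_comm) as M.
apply is_derive_RC_iff; split.
- evar_last; [exact (is_derive_minus _ _ t _ _ (M _ _ _ _ Hr Kr) (M _ _ _ _ Hi Ki))|].
  cbn; unfold Re, Im; ring.
- evar_last; [exact (is_derive_plus _ _ t _ _ (M _ _ _ _ Hr Ki) (M _ _ _ _ Hi Kr))|].
  cbn; unfold Re, Im; ring.
Qed.

(** Differentiation is local and the interval is the ball of radius [eps0] about 0. This lets
    equations known only for parameters in the interval be differentiated at 0. *)
Lemma is_derive_RC_ext_interval (eps0 : R) (h k : R -> C) (l : C) :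
  (0 < eps0)%R ->
  (forall s : R, (- eps0 < s < eps0)%R -> h s = k s) ->
  is_derive_RC h 0%R l -> is_derive_RC k 0%R l.
Proof.
intros He E; apply is_derive_ext_loc.
exists (mkposreal eps0 He); intros s Hs; apply E.
apply Rabs_lt_between; replace s with (s - 0)%R by ring; exact Hs.
Qed.

(** The three sides form a path [y1], [x0], [y0], [x1] through all corners, so increments along them
    determine those along both diagonals. *)
Lemma face_adjacent (D : bipartite_quad_graph) (x0 y0 x1 y1 : vertex D) :
  is_face D x0 y0 x1 y1 ->
  adjacent D x0 y0 /\ adjacent D x0 y1 /\ adjacent D y0 x1.
Proof.
intros [c Hc].
destruct (side_q0 D c) as [b0 w0], (side_q1 D c) as [w1 b1],
  (side_q2 D c) as [b2 w2], (side_q3 D c) as [w3 b3].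
destruct Hc as [E|[E|[E|E]]]; injection E as -> -> -> ->;
  repeat split;
  first [ exists (side D c q0); tauto | exists (side D c q1); tauto
        | exists (side D c q2); tauto | exists (side D c q3); tauto ].
Qed.

Lemma Cminus_eq_0 (a b : C) : a - b = 0 -> a = b.
Proof. intros H; replace a with (a - b + b) by ring; rewrite H; ring. Qed.

Lemma C_div_mult_eq (a b u v : C) : b <> 0 -> b * u = a * v -> u = a / b * v.
Proof.
intros Hb E; replace (a / b * v) with (a * v / b) by (field; exact Hb).
rewrite <- E; field; exact Hb.
Qed.

Lemma hirota_linearized (D : bipartite_quad_graph)
    (theta : vertex D -> vertex D -> C) (eps0 : R) (w : R -> vertex D -> C)
    (f : vertex D -> C) :
  (0 < eps0)%R ->
  (forall eps : R, (- eps0 < eps < eps0)%R -> hirota_solution D theta (w eps)) ->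
  (forall v, w 0%R v = 1) ->
  (forall v, is_derive_RC (fun eps => w eps v) 0%R (f v)) ->
  forall x0 y0 x1 y1, is_face D x0 y0 x1 y1 ->
  (theta x0 y1 + theta x0 y0) * (f y1 - f y0) =
  (theta x0 y1 - theta x0 y0) * (f x1 - f x0).
Proof.
intros He Hs H0 Hd x0 y0 x1 y1 F.
set (a := theta x0 y0); set (b := theta x0 y1).
pose proof (fun (c : C) (x y : vertex D) =>
  is_derive_RC_mult _ _ _ _ _
    (is_derive_RC_mult _ _ _ _ _ (is_derive_RC_const c 0%R) (Hd x)) (Hd y)) as M.
pose proof (is_derive_RC_minus _ _ _ _ _ (is_derive_RC_minus _ _ _ _ _
  (is_derive_RC_plus _ _ _ _ _ (M a x0 y0) (M b y0 x1)) (M a x1 y1)) (M b y1 x0)) as H.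
(* The Hirota expression vanishes on the whole interval, so the derivative found by the product rule
   must be 0. *)
apply (is_derive_RC_ext_interval eps0 _ (fun _ => 0) _ He) in H;
  [|intros s I; exact (Hs s I _ _ _ _ F)].
pose proof (is_derive_RC_unique _ _ _ _ H (is_derive_RC_const 0 0%R)) as E.
cbv beta in E; rewrite !H0 in E.
(* At $w=1$, [E] reads $a(f(x_0)+f(y_0))+b(f(y_0)+f(x_1))-a(f(x_1)+f(y_1))-b(f(y_1)+f(x_0))=0$;
   collecting the terms by vertex gives the claim. *)
symmetry; apply Cminus_eq_0; rewrite <- E; ring.
Qed.

Lemma correspondence_linearized (D : bipartite_quad_graph) (p : vertex D -> C)
    (eps0 : R) (z w : R -> vertex D -> C) (g f : vertex D -> C) :
  (0 < eps0)%R ->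
  (forall eps : R, (- eps0 < eps < eps0)%R -> corresponding D p (z eps) (w eps)) ->
  (forall v, w 0%R v = 1) ->
  (forall v, is_derive_RC (fun eps => z eps v) 0%R (g v)) ->
  (forall v, is_derive_RC (fun eps => w eps v) 0%R (f v)) ->
  forall x y, adjacent D x y -> g y - g x = (f x + f y) * (p y - p x).
Proof.
intros He Hs H0 Hg Hf x y A.
pose proof (is_derive_RC_minus _ _ _ _ _ (Hg y) (Hg x)) as L.
apply (is_derive_RC_ext_interval eps0 _ _ _ He (fun s I => Hs s I x y A)) in L.
pose proof (is_derive_RC_mult _ _ _ _ _
  (is_derive_RC_mult _ _ _ _ _ (Hf x) (Hf y))
  (is_derive_RC_const (p y - p x) 0%R)) as M.
rewrite (is_derive_RC_unique _ _ _ _ L M), !H0; ring.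
Qed.

Theorem theorem6p18
  (D : bipartite_quad_graph)
  (theta : vertex D -> vertex D -> C) (p : vertex D -> C)
  (hp : parallelogram_realization D theta p)
  (eps0 : R) (heps0 : (0 < eps0)%R)
  (z : R -> vertex D -> C)
  (hz_diff : differentiable_family (vertex D) eps0 z)
  (hz_sol : forall eps : R, (- eps0 < eps < eps0)%R ->
              cross_ratio_solution D theta (z eps))
  (hz0 : forall v : vertex D, z 0%R v = p v)
  (w : R -> vertex D -> C)
  (hw_diff : differentiable_family (vertex D) eps0 w)
  (hw_sol : forall eps : R, (- eps0 < eps < eps0)%R ->
              hirota_solution D theta (w eps))
  (hzw : forall eps : R, (- eps0 < eps < eps0)%R ->
           corresponding D p (z eps) (w eps))
  (hw0 : forall v : vertex D, w 0%R v = 1)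
  (g : vertex D -> C)
  (hg : forall v : vertex D, is_derive_RC (fun eps => z eps v) 0%R (g v))
  (dw : vertex D -> C)
  (hdw : forall v : vertex D, is_derive_RC (fun eps => w eps v) 0%R (dw v))
  (f : vertex D -> C)
  (hf : forall v : vertex D, f v = / w 0%R v * dw v) :
  discrete_cauchy_riemann D theta p f /\ discrete_cauchy_riemann D theta p g.
Proof.
assert (Hf : forall v, dw v = f v) by (intros v; rewrite hf, hw0; field; apply C1_nz).
assert (hdf : forall v, is_derive_RC (fun eps => w eps v) 0%R (f v))
  by (intros v; rewrite <- Hf; apply hdw).
pose proof (hirota_linearized D theta eps0 w f heps0 hw_sol hw0 hdf) as CRf.
pose proof (correspondence_linearized D p eps0 z w g f heps0 hzw hw0 hg hdf) as Eg.
destruct hp as [hedge hface].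
(* The non-vanishing and the ratio identity concern [theta] and [p] only, so they serve both [f] and
   [g]. *)
enough (forall x0 y0 x1 y1, is_face D x0 y0 x1 y1 ->
  theta x0 y1 + theta x0 y0 <> 0 /\
  (theta x0 y1 - theta x0 y0) / (theta x0 y1 + theta x0 y0) =
    (p y1 - p y0) / (p x1 - p x0) /\
  (theta x0 y1 + theta x0 y0) * (g y1 - g y0) =
    (theta x0 y1 - theta x0 y0) * (g x1 - g x0)) as K.
{ split; intros x0 y0 x1 y1 F; destruct (K _ _ _ _ F) as (nz & ratio & CRg);
    (split; [apply C_div_mult_eq; [exact nz|] | exact ratio]).
  - exact (CRf _ _ _ _ F).
  - exact CRg. }
intros x0 y0 x1 y1 F.
specialize (CRf _ _ _ _ F).
destruct (hface _ _ _ _ F) as (_ & e1 & _ & _ & _ & ne).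
destruct (face_adjacent D _ _ _ _ F) as (A00 & A01 & A10).
pose proof (Eg _ _ A00) as G00; pose proof (Eg _ _ A01) as G01; pose proof (Eg _ _ A10) as G10.
(* Opposite sides of the parallelogram carry equal labels, so only [theta x0 y0] and [theta x0 y1]
   remain. *)
apply hedge in A00, A01, A10; rewrite <- e1 in A10.
rewrite A00 in G00; rewrite A01 in G01; rewrite A10 in G10.
set (a := theta x0 y0) in *; set (b := theta x0 y1) in *.
split; [|split].
- intros E; apply ne; apply Cminus_eq_0; rewrite <- E; ring.
- replace (p y1 - p y0) with (b - a) by (rewrite <- A00, <- A01; ring).
  replace (p x1 - p x0) with (b + a) by (rewrite <- A00, <- A10; ring).
  reflexivity.
(* Each diagonal increment of [g] is summed over two sides: [y0] to [y1] through [x0], and [x0] to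
   [x1] through [y0]. *)
- replace (g y1 - g y0) with ((f x0 + f y1) * b - (f x0 + f y0) * a)
    by (rewrite <- G00, <- G01; ring).
  replace (g x1 - g x0) with ((f y0 + f x1) * b + (f x0 + f y0) * a)
    by (rewrite <- G00, <- G10; ring).
  apply Cminus_eq_0.
  (* The defect of [g] in the cleared equation is exactly [b] times the defect of [f], which is zero
     by [CRf]. *)
  transitivity (b * ((b + a) * (f y1 - f y0) - (b - a) * (f x1 - f x0))); [ring|].
  rewrite CRf; ring.
Qed.
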